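(* Let $G$ be either $G_n=\overline{C_n}$ with $n\ge 3$ (the graph complement of the cycle graph with $n$ vertices) or $G_n^+=\overline{L_n}$ with $n\ge 1$ (the graph complement of the path graph with $n$ vertices). Then for every proper subset $W$ of the vertex set of $G$, the subgraph of $G$ induced by $W$ is either contractible or homotopic to a $d$-sphere for some $d\ge -1$.
   Context: All graphs are finite and simple. The unit sphere $S(x)$ of a vertex $x$ is the subgraph induced by the neighbors of $x$. A graph is contractible if it is the one-point graph $K_1$ or (inductively) if it has a vertex $x$ such that both $S(x)$ and the graph $G-x$ with $x$ removed are contractible. A homotopy extension of $G$ adds a new vertex joined exactly to the vertices of a contractible induced subgraph $A$ of $G$; a homotopy reduction is the reverse (removing a vertex $x$ with $S(x)$ contractible). Two graphs are homotopic if one is obtained from the other by finitely many homotopy extensions and reductions. Spheres are defined inductively: the empty graph is the $(-1)$-sphere, and for $d\ge 0$ a $d$-sphere is a graph all of whose unit spheres are $(d-1)$-spheres and which becomes contractible after removing some vertex. *)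

(* Defs.v *)
From HB Require Import structures.
From mathcomp Require Import all_boot all_order all_algebra.

Set Implicit Arguments.
Unset Strict Implicit.
Unset Printing Implicit Defensive.

Import Order.TTheory GRing.Theory Num.Theory.

Record sgraph := SGraph {
  vertex :> finType;
  adj : rel vertex;
  adj_sym : symmetric adj;
  adj_irr : irreflexive adj }.

Definition iso (G H : sgraph) : Prop :=
  exists f : G -> H, bijective f /\ forall x y, adj (f x) (f y) = adj x y.

Section Induced.
Variables (G : sgraph) (W : {set G}).

Definition induced_adj : rel {x : G | x \in W} :=
  fun u v => adj (val u) (val v).

Lemma induced_sym : symmetric induced_adj.
Proof. by move=> u v; exact: adj_sym. Qed.

Lemma induced_irr : irreflexive induced_adj.
Proof. by move=> u; exact: adj_irr. Qed.

Definition induced : sgraph := SGraph induced_sym induced_irr.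
End Induced.

Definition unit_sphere (G : sgraph) (x : G) : sgraph :=
  induced [set y | adj x y].

Definition remove (G : sgraph) (x : G) : sgraph := induced [set~ x].

(* The empty graph is not contractible. *)
Inductive contractible : sgraph -> Prop :=
| contractible_K1 (G : sgraph) : #|vertex G| = 1 -> contractible G
| contractible_rec (G : sgraph) (x : G) :
    contractible (unit_sphere x) -> contractible (remove x) -> contractible G.

(* [add_vertex A] is G with a new vertex, None, joined exactly to A. *)
Section AddVertex.
Variables (G : sgraph) (A : {set G}).

Definition add_vertex_adj : rel (option G) := fun u v =>
  match u, v with
  | Some x, Some y => adj x y
  | Some x, None | None, Some x => x \in A
  | None, None => false
  end.

Lemma add_vertex_sym : symmetric add_vertex_adj.
Proof. by case=> [x|] [y|] //=; exact: adj_sym. Qed.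

Lemma add_vertex_irr : irreflexive add_vertex_adj.
Proof. by case=> [x|] //=; exact: adj_irr. Qed.

Definition add_vertex : sgraph := SGraph add_vertex_sym add_vertex_irr.
End AddVertex.

(* [homotopic G H]: H arises from G by finitely many homotopy extensions and
   reductions, graphs being identified up to isomorphism. *)
Inductive homotopic (G : sgraph) : sgraph -> Prop :=
| homotopic_refl : homotopic G G
| homotopic_iso (H K : sgraph) : homotopic G H -> iso H K -> homotopic G K
| homotopic_extension (H : sgraph) (A : {set H}) :
    homotopic G H -> contractible (induced A) -> homotopic G (add_vertex A)
| homotopic_reduction (H : sgraph) (x : H) :
    homotopic G H -> contractible (unit_sphere x) -> homotopic G (remove x).

Inductive sphere : int -> sgraph -> Prop :=
| sphere_empty (G : sgraph) : #|vertex G| = 0 -> sphere (-1)%R G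
| sphere_rec (d : int) (G : sgraph) :
    (0 <= d)%R ->
    (forall x : G, sphere (d - 1)%R (unit_sphere x)) ->
    (exists x : G, contractible (remove x)) ->
    sphere d G.

Section Complement.
Variable G : sgraph.

Definition compl_adj : rel G := fun x y => (x != y) && ~~ adj x y.

Lemma compl_sym : symmetric compl_adj.
Proof. by move=> x y; rewrite /compl_adj eq_sym adj_sym. Qed.

Lemma compl_irr : irreflexive compl_adj.
Proof. by move=> x; rewrite /compl_adj eqxx. Qed.

Definition compl : sgraph := SGraph compl_sym compl_irr.
End Complement.

Section CyclePath.
Variable n : nat.

(* [ordS] is the successor modulo n.  The conjunct [i != j] only matters for
   n = 1, where [ordS i = i]; this is the cycle graph for n >= 3. *)
Definition cycle_adj : rel 'I_n := fun i j =>
  (i != j) && ((j == ordS i) || (i == ordS j)).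

Lemma cycle_sym : symmetric cycle_adj.
Proof. by move=> i j; rewrite /cycle_adj eq_sym orbC. Qed.

Lemma cycle_irr : irreflexive cycle_adj.
Proof. by move=> i; rewrite /cycle_adj eqxx. Qed.

Definition cycle_graph : sgraph := SGraph cycle_sym cycle_irr.

Definition path_adj : rel 'I_n := fun i j =>
  (j == i.+1 :> nat) || (i == j.+1 :> nat).

Lemma path_sym : symmetric path_adj.
Proof. by move=> i j; rewrite /path_adj orbC. Qed.

Lemma path_irr : irreflexive path_adj.
Proof. by move=> i; rewrite /path_adj orbb ltn_eqF. Qed.

Definition path_graph : sgraph := SGraph path_sym path_irr.
End CyclePath.

(* Main.v *)
Require Import Defs.
From mathcomp Require Import all_boot all_order all_algebra.

Set Implicit Arguments.
Unset Strict Implicit.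
Unset Printing Implicit Defensive.

(** The clique complex of a graph is the independence complex of its
    complement, so it pays to look at the complement [F] of the graph induced
    by [W].  A proper induced subgraph of a cycle, and any induced subgraph of
    a path, is a forest; and the dichotomy holds for every graph [G] whose
    complement [F] is a forest, by induction on the number of vertices:
    - if [F] has an isolated vertex, [G] is a cone, hence contractible
      ([contractible_cone]);
    - if the [F]-neighbours of [u] are also [F]-neighbours of another vertex
      [v], where [u] and [v] are not joined in [F], then in [G] the unit sphere
      of [v] is a cone with apex [u] ([contractible_unit_sphere_dominated]), so
      deleting [v] is a homotopy reduction, and it also reflects
      contractibility;
    - otherwise the forest [F] is a perfect matching
      ([coforest_dominated_or_matching]) and [G] is a cross-polytope, which is
      a sphere: its unit spheres are smaller cross-polytopes, and deleting a
      vertex leaves a cone over the antipode ([sphere_cross_polytope]).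

    In the second case [u] is a leaf and [v] lies at distance two from it; this
    is why forests, rather than only disjoint unions of paths, are the natural
    generality. *)

(** A graph is a forest exactly when each of its nonempty induced subgraphs has
    a vertex of degree at most one.  This form of acyclicity, here for the
    complement of [G], is all that the argument needs, and it visibly passes to
    induced subgraphs. *)
Definition coforest (G : sgraph) : Prop :=
  forall A : {set G}, A != set0 ->
  exists2 u, u \in A & {in A &, forall v w,
    compl_adj u v -> compl_adj u w -> v = w}.

(** The clique complex of such a graph is the boundary of a cross-polytope, a
    vertex and its unique non-neighbour being antipodal. *)
Definition cross_polytope (G : sgraph) : Prop :=
  forall x : G, exists2 x', compl_adj x x' & forall y, compl_adj x y -> y = x'.

Lemma compl_adj_induced (G : sgraph) (W : {set G}) (u v : induced W) :
  compl_adj u v = compl_adj (val u) (val v).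
Proof. by []. Qed.

Lemma compl_adj_compl (G : sgraph) (u v : G) :
  @compl_adj (compl G) u v = adj u v.
Proof.
rewrite /compl_adj /= /compl_adj.
by have [->|_] := eqVneq u v; rewrite ?adj_irr ?negbK.
Qed.

Lemma card_induced (G : sgraph) (W : {set G}) : #|vertex (induced W)| = #|W|.
Proof. by rewrite card_sig. Qed.

Lemma card_remove (G : sgraph) (x : G) :
  #|vertex (remove x)| = #|vertex G|.-1.
Proof. by rewrite card_induced cardsC1. Qed.

Lemma card_remove_lt (G : sgraph) (x : G) :
  #|vertex (remove x)| < #|vertex G|.
Proof. by rewrite card_remove prednK //; apply/card_gt0P; exists x. Qed.

Lemma card_unit_sphere_lt (G : sgraph) (x : G) :
  #|vertex (unit_sphere x)| < #|vertex G|.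
Proof.
rewrite card_induced -cardsT; apply/proper_card/properP; split.
  exact: subsetT.
by exists x; rewrite ?inE ?adj_irr.
Qed.

Lemma coforest_induced (G : sgraph) (W : {set G}) :
  coforest G -> coforest (induced W).
Proof.
move=> cofG A /set0Pn[a aA].
have [|_ /imsetP[u uA ->] uniq_u] := cofG (val @: A).
  by apply/set0Pn; exists (val a); rewrite imset_f.
exists u => // v w vA wA uv uw; apply/val_inj.
exact: (uniq_u _ _ (imset_f _ vA) (imset_f _ wA)).
Qed.

Lemma homotopic_trans (G H K : sgraph) :
  homotopic G H -> homotopic H K -> homotopic G K.
Proof.
move=> GH; elim=> [//|L M _ GL LM|L A _ GL cA|L x _ GL cx].
- exact: homotopic_iso GL LM.
- exact: homotopic_extension.
- exact: homotopic_reduction.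
Qed.

(** Away from the apex, the unit sphere of a vertex and the graph left when it
    is deleted are again cones with the same apex. *)
Lemma contractible_cone (G : sgraph) (a : G) :
  (forall y, y != a -> adj a y) -> contractible G.
Proof.
have [n] := ubnP #|vertex G|.
elim: n => // n IHn in G a * => /ltnSE-leGn a_apex.
have [x xa | onlya] := pickP (predC1 a); last first.
  apply: contractible_K1; rewrite -(card1 a).
  by apply: eq_card => y; have /negbFE := onlya y.
have ax := a_apex x xa.
have aS : a \in [set y | adj x y] by rewrite inE adj_sym.
have aR : a \in [set~ x] by rewrite !inE eq_sym.
apply: (@contractible_rec G x).
- apply: (IHn (unit_sphere x) (exist _ a aS)) => [|y ya].
    exact: leq_trans (card_unit_sphere_lt _) leGn.
  exact: a_apex.
- apply: (IHn (remove x) (exist _ a aR)) => [|y ya].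
    exact: leq_trans (card_remove_lt _) leGn.
  exact: a_apex.
Qed.

(** A neighbour of [v] is joined to [u], since by domination a non-neighbour of
    [u] is also one of [v]; hence [u] is an apex of the unit sphere of [v]. *)
Lemma contractible_unit_sphere_dominated (G : sgraph) (u v : G) :
  adj u v -> (forall w, compl_adj u w -> compl_adj v w) ->
  contractible (unit_sphere v).
Proof.
move=> uv dom; have uS : u \in [set y | adj v y] by rewrite inE adj_sym.
apply: (@contractible_cone (unit_sphere v) (exist _ u uS)) => y.
rewrite -val_eqE /= /induced_adj /= => yu.
have : val y \in [set y | adj v y] := valP y.
rewrite inE; apply: contraTT => nuy.
have /andP[] // : compl_adj v (val y).
by apply: dom; rewrite /compl_adj nuy andbT eq_sym.
Qed.

(** The antipode of a neighbour [y] of [x] is a neighbour of [x]: it differs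
    from [x], and if it were not joined to [x] then its two antipodes [x] and
    [y] would coincide. *)
Lemma cross_polytope_unit_sphere (G : sgraph) (x : G) :
  cross_polytope G -> cross_polytope (unit_sphere x).
Proof.
move=> xG [y yS]; have [y' yy' uniq_y] := xG y.
have xy : adj x y by rewrite inE in yS.
have y'S : y' \in [set z | adj x z].
  rewrite inE; apply: contraT => nxy'.
  have xy' : compl_adj x y'.
    rewrite /compl_adj nxy' andbT; apply/eqP=> xy'.
    by case/andP: yy'; rewrite -xy' adj_sym xy.
  have [z _ uniq_y'] := xG y'.
  rewrite compl_sym in yy'; rewrite compl_sym in xy'.
  by rewrite (uniq_y' _ yy') -(uniq_y' _ xy') adj_irr in xy.
by exists (exist _ y' y'S) => // -[z zS] yz; apply/val_inj/uniq_y.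
Qed.

Lemma card_unit_sphere_cross_polytope (G : sgraph) (x : G) :
  cross_polytope G -> #|vertex G| = #|vertex (unit_sphere x)|.+2.
Proof.
move=> xG; have [x' xx' uniq_x] := xG x.
rewrite card_induced -(cardsC [set x; x']) cards2.
case/andP: (xx') => -> nxx'; congr (_.+2).
apply: eq_card => y; rewrite !inE negb_or; apply/andP/idP => [[yx yx']|xy].
  apply: contraT => nxy; case/negP: yx'; apply/eqP/uniq_x.
  by rewrite /compl_adj eq_sym yx.
split; apply: contraTneq xy => ->; by [rewrite adj_irr | rewrite nxx'].
Qed.

(** Passing to a unit sphere removes one antipodal pair, which is why the
    dimension is one less than the number of pairs.  Deleting [x] leaves its
    antipode [x'] joined to everything else. *)
Lemma sphere_cross_polytope (G : sgraph) :
  cross_polytope G -> sphere ((#|vertex G|./2)%:Z - 1)%R G.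
Proof.
have [n] := ubnP #|vertex G|.
elim: n => // n IHn in G * => /ltnSE-leGn xG.
have [x _ | G0] := pickP (predT : pred G); last first.
  have G0' : #|vertex G| = 0 by apply: eq_card0.
  by rewrite G0'; apply: sphere_empty.
apply: sphere_rec => [|y|].
- by rewrite (card_unit_sphere_cross_polytope x xG) /= -addn1 PoszD GRing.addrK.
- rewrite (card_unit_sphere_cross_polytope y xG) /= -addn1 PoszD GRing.addrK.
  apply: (IHn (unit_sphere y)); last exact: cross_polytope_unit_sphere.
  exact: leq_trans (card_unit_sphere_lt _) leGn.
- exists x; have [x' xx' uniq_x] := xG x.
  have x'R : x' \in [set~ x] by rewrite !inE eq_sym; case/andP: xx'.
  apply: (@contractible_cone (remove x) (exist _ x' x'R)) => y.
  rewrite -val_eqE /= /induced_adj /= => yx'.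
  have : val y \in [set~ x] := valP y.
  rewrite !inE; apply: contraNT => nx'y.
  have [z _ uniq_x'] := xG x'.
  have x'y : compl_adj x' (val y) by rewrite /compl_adj nx'y andbT eq_sym.
  rewrite compl_sym in xx'.
  by rewrite (uniq_x' _ x'y) (uniq_x' _ xx').
Qed.

(** Without isolated vertices in the complement, suppose some vertices have
    degree at least two there.  Among these, acyclicity provides a vertex [w]
    with at most one neighbour of the same kind, so another neighbour [u] of
    [w] is a leaf, and any further neighbour [v] of [w] is dominated by [u]. *)
Lemma coforest_dominated_or_matching (G : sgraph) :
  coforest G -> (forall x : G, exists y, compl_adj x y) ->
  (exists u v : G, adj u v /\ forall w, compl_adj u w -> compl_adj v w) \/
  cross_polytope G.
Proof.
move=> cofG noniso.
pose deg2 (x : G) :=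
  [exists y, exists z, [&& y != z, compl_adj x y & compl_adj x z]].
have leaf x : ~~ deg2 x -> {in compl_adj x &, forall y z, y = z}.
  move=> nx y z xy xz; apply: contraNeq nx => yz.
  by apply/existsP; exists y; apply/existsP; exists z; apply/and3P.
have [A0 | /cofG[w]] := eqVneq [set x | deg2 x] set0.
  right=> x; have [x' xx'] := noniso x; exists x' => // y xy.
  by apply: (leaf x) => //; have := in_set0 x; rewrite -A0 inE => ->.
rewrite inE => /existsP[y /existsP[z /and3P[yz wy wz]]] uniq_w; left.
have dominated (u v : G) : u != v -> compl_adj w u -> compl_adj w v ->
    ~~ deg2 u -> exists u v : G,
    adj u v /\ forall w, compl_adj u w -> compl_adj v w.
  move=> uv wu wv /leaf leaf_u; have uw : compl_adj u w by rewrite compl_sym.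
  exists u, v; split=> [|t ut]; last first.
    by rewrite (leaf_u t w) // compl_sym.
  apply: contraT => nuv; have uv' : compl_adj u v by rewrite /compl_adj uv.
  by move: wv; rewrite (leaf_u v w) // compl_irr.
have [y2 | ] := boolP (deg2 y); last exact: (dominated y z).
have [z2 | ] := boolP (deg2 z); last by apply: (dominated z y); rewrite // eq_sym.
by case/eqP: yz; apply: uniq_w; rewrite ?inE.
Qed.

Lemma coforest_contractible_or_sphere (G : sgraph) :
  coforest G ->
  contractible G \/
  exists (d : int) (S : sgraph), (-1 <= d)%R /\ sphere d S /\ homotopic G S.
Proof.
have [n] := ubnP #|vertex G|.
elim: n => // n IHn in G * => /ltnSE-leGn cofG.
have [a isoa | noniso] := pickP (fun x : G => [forall y, ~~ compl_adj x y]).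
  left; apply: (@contractible_cone G a) => y ya.
  by have /forallP/(_ y) := isoa; rewrite /compl_adj eq_sym ya negbK.
have [x | [u [v [uv dom]]] | xG] := coforest_dominated_or_matching cofG.
- by have /negbT/forallPn[y /negbNE] := noniso x; exists y.
- have cSv := contractible_unit_sphere_dominated uv dom.
  have ltR := leq_trans (card_remove_lt v) leGn.
  have [cR | [d [S [led [sphS RS]]]]] := IHn _ ltR (coforest_induced cofG).
    by left; apply: contractible_rec cSv cR.
  right; exists d, S; split=> //; split=> //.
  apply: homotopic_trans RS; apply: homotopic_reduction cSv.
  exact: homotopic_refl.
- right; exists ((#|vertex G|./2)%:Z - 1)%R, G; split=> //.
    by rewrite Num.Theory.lerBrDr.
  by split; [apply: sphere_cross_polytope | apply: homotopic_refl].
Qed.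

(** A nonempty set of residues closed under the successor is everything, so a
    nonempty subset of [W] has an element whose successor lies outside; only
    its predecessor can then be a neighbour within the subset. *)
Lemma coforest_induced_compl_cycle (n : nat) (W : {set compl (cycle_graph n)}) :
  W \proper [set: compl (cycle_graph n)] -> coforest (induced W).
Proof.
case: n W => [|n] W; first by case/properP=> _ [[]].
case/properP=> _ [b _ bW] A /set0Pn[a aA].
pose B : {set 'I_n.+1} := val @: A.
have BW x : x \in B -> x \in W by case/imsetP=> y _ ->; exact: valP.
have [u uB uSB] : exists2 u, u \in B & ordS u \notin B.
  have [/exists_inP // | ] := boolP [exists u in B, ordS u \notin B].
  move/exists_inPn=> closedB; case/negP: bW; apply: BW.
  have iterB k : iter k (@ordS n.+1) (val a) \in B.
    elim: k => [|k IHk] /=; first exact: imset_f.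
    exact/negbNE/closedB.
  have iterE k : iter k (@ordS n.+1) (val a) = (val a + k) %% n.+1 :> nat.
    elim: k => [|k IHk] /=; first by rewrite addn0 modn_small.
    by rewrite IHk addnS -addn1 modnDml addn1.
  (* [b] is reached from [a] after [n.+1 - a + b] steps, modulo [n.+1]. *)
  suff <- : iter (n.+1 - val a + b) (@ordS n.+1) (val a) = b by [].
  apply/val_inj; rewrite /= iterE addnA subnKC ?modnDl ?modn_small //.
  exact: ltnW.
case/imsetP: uB => u' u'A uE; exists u' => // v w vA wA.
have pred_u (x : induced W) : x \in A ->
    @compl_adj (induced W) u' x -> u = ordS (val x).
  move=> xA; rewrite compl_adj_induced -uE compl_adj_compl.
  case/andP=> _ /orP[/eqP xE | /eqP //].
  by case/negP: uSB; rewrite -xE imset_f.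
move=> /(pred_u _ vA) uv /(pred_u _ wA) uw.
by apply/val_inj/(@ordS_inj n.+1); rewrite -uv -uw.
Qed.

(** In a set of vertices of a path, the largest one has no neighbour but its
    predecessor. *)
Lemma coforest_compl_path (n : nat) : coforest (compl (path_graph n)).
Proof.
move=> A /set0Pn[a aA].
have [u uA max_u] := arg_maxnP (fun i : 'I_n => val i) aA.
exists u => // v w vA wA.
have pred_u (x : 'I_n) : x \in A ->
    @compl_adj (compl (path_graph n)) u x -> u = x.+1 :> nat.
  move=> xA; rewrite compl_adj_compl.
  case/orP=> /eqP // xE; have := max_u x xA.
  by rewrite /= xE ltnn.
move=> /(pred_u _ vA) uv /(pred_u _ wA) uw.
by apply/val_inj/succn_inj; rewrite -uv -uw.
Qed.

Theorem theorem4 (G : sgraph)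
  (hG : (exists n : nat, 3 <= n /\ G = compl (cycle_graph n)) \/
        (exists n : nat, 1 <= n /\ G = compl (path_graph n)))
  (W : {set G}) (hW : W \proper [set: G]) :
  contractible (induced W) \/
  exists (d : int) (S : sgraph),
    (-1 <= d)%R /\ sphere d S /\ homotopic (induced W) S.
Proof.
apply: coforest_contractible_or_sphere.
case: hG => -[n [_ GE]]; subst G.
- exact: coforest_induced_compl_cycle.
- exact/coforest_induced/coforest_compl_path.
Qed.
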